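(* Let $d\ge 2$ and $k$ be integers with $0\le k\le d-1$. Then there is an integer $n=n(d,k)$ and a set of $n$ $k$-flats in $\mathbb{R}^d$ in general position which is not in convex position.
   Context: A $k$-flat is an affine subspace of $\mathbb{R}^d$ of dimension $k$. A set $\{U_1,\ldots,U_n\}$ of $k$-flats in $\mathbb{R}^d$ ($0\le k\le d-1$) is in convex position if there is a $d$-dimensional convex polytope $P\subset\mathbb{R}^d$ such that $U_i\cap P$ is a $k$-dimensional face of $P$ for every $i\in[n]$. General position: if $0\le k\le d-2$, the $k$-flats $U_1,\ldots,U_n$ are in general position if there is a $(d-k)$-flat $A$ such that $U_i\cap A$ is a single point for every $i$, no three of these $n$ points are collinear, and their affine hull equals $A$. If $k=d-1$, $n\ge d$ hyperplanes are in general position if every $d$ of them intersect in a single point and these $\binom nd$ points are pairwise distinct. *)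

(* Defs.v *)
From HB Require Import structures.
From mathcomp Require Import all_boot all_order all_algebra.
From mathcomp Require Import reals.
Set Implicit Arguments. Unset Strict Implicit. Unset Printing Implicit Defensive.
Import Order.TTheory GRing.Theory Num.Theory.
Local Open Scope ring_scope.

Section Geometry.
Variables (R : realType) (d : nat).
Local Notation pt := 'rV[R]_d.
Local Notation pset := (pt -> Prop).

Definition dotp (a x : pt) : R := \sum_(i < d) a 0 i * x 0 i.

Definition is_flat (k : nat) (U : pset) : Prop :=
  exists (p : pt) (B : 'M[R]_(k, d)), row_free B /\
    forall x, U x <-> exists v : 'rV[R]_k, x = p + v *m B.

(* the affine hull of S has dimension k: S contains k+1 affinely independent
   points p, p + row i B (B of rank k), and S lies in their affine hull *)
Definition aff_dim (S : pset) (k : nat) : Prop :=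
  exists (p : pt) (B : 'M[R]_(k, d)), row_free B /\ S p /\
    (forall i, S (p + row i B)) /\
    (forall x, S x -> exists v : 'rV[R]_k, x = p + v *m B).

Definition is_polytope (P : pset) : Prop :=
  exists (m : nat) (q : 'I_m -> pt), forall x, P x <->
    exists l : 'I_m -> R, (forall i, 0 <= l i) /\ \sum_(i < m) l i = 1 /\
      x = \sum_(i < m) l i *: q i.

(* F is a face of P: the intersection of P with {a.x = b} for a valid
   inequality a.x <= b of P (a = 0 allowed, as usual) *)
Definition is_face (P F : pset) : Prop :=
  exists (a : pt) (b : R), (forall x, P x -> dotp a x <= b) /\
    forall x, F x <-> (P x /\ dotp a x = b).

Definition convex_position (k n : nat) (U : 'I_n -> pset) : Prop :=
  exists P : pset, is_polytope P /\ aff_dim P d /\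
    forall i, is_face P (fun x => U i x /\ P x) /\
              aff_dim (fun x => U i x /\ P x) k.

Definition collinear3 (a b c : pt) : Prop :=
  exists p v : pt, forall x, x \in [:: a; b; c] -> exists t : R, x = p + t *: v.

Definition general_position_low (k n : nat) (U : 'I_n -> pset) : Prop :=
  exists (A : pset) (q : 'I_n -> pt), is_flat (d - k) A /\
    (forall i x, (U i x /\ A x) <-> x = q i) /\
    (forall i j l, i != j -> j != l -> i != l -> ~ collinear3 (q i) (q j) (q l)) /\
    (forall x, A x <-> exists lam : 'I_n -> R, \sum_(i < n) lam i = 1 /\
                         x = \sum_(i < n) lam i *: q i).

Definition general_position_hyp (n : nat) (U : 'I_n -> pset) : Prop :=
  (d <= n)%N /\
  exists p : {set 'I_n} -> pt,
    (forall S : {set 'I_n}, #|S| = d ->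
       forall x, (forall i, i \in S -> U i x) <-> x = p S) /\
    (forall S S' : {set 'I_n}, #|S| = d -> #|S'| = d -> S != S' -> p S != p S').

Definition general_position (k n : nat) (U : 'I_n -> pset) : Prop :=
  if (k <= d - 2)%N then general_position_low k U
  else general_position_hyp U.

End Geometry.

(* Main.v *)
Require Import Defs.
From HB Require Import structures.
From mathcomp Require Import all_boot all_order all_algebra.
From mathcomp Require Import boolp reals.
From mathcomp Require Import ring lra.
Set Implicit Arguments. Unset Strict Implicit. Unset Printing Implicit Defensive.
Import Order.TTheory GRing.Theory Num.Theory.
Local Open Scope ring_scope.

(** For k <= d - 2, take parallel k-flats through the vertices of a simplex of a
    complementary (d - k)-flat and through its barycentre. If all of them met P in
    faces, the average of points of P on the outer flats would lie on the central
    one; since that one cuts P in a face, the outer points would lie on it too.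

    For k = d - 1, encode a hyperplane by w in R^(d+1), the zero set of
    x |-> w . (x, -1). A hyperplane cutting a convex P in a face has P weakly on
    one side. For every open orthant of R^(d+1), put into the family a basis t
    lying in the orthant and a positive combination w0 of t. An interior point x
    of P picks an orthant on which w . (x, -1) > 0, so P is on the nonnegative
    side of every member of t; at a point y of P on the hyperplane w0 all members
    of t then vanish on (y, -1), which is absurd. All conditions on the vectors are
    open, so they can be chosen one after the other outside the finitely many
    proper subspaces spanned by the earlier ones and the vector (0, 1) at infinity;
    this gives general position. *)

(** * Convex combinations in polytopes and their faces *)

Section Faces.
Variables (R : realType) (d : nat).
Implicit Types P F : 'rV[R]_d -> Prop.

Lemma dotp_sumr (I : finType) (a : 'rV[R]_d) (l : I -> R) (y : I -> 'rV[R]_d) :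
  dotp a (\sum_i l i *: y i) = \sum_i l i * dotp a (y i).
Proof.
rewrite /dotp; under [RHS]eq_bigr do rewrite mulr_sumr.
rewrite exchange_big; apply: eq_bigr => j _ /=.
rewrite summxE mulr_sumr; apply: eq_bigr => i _; rewrite mxE; ring.
Qed.

Lemma polytope_convex P (I : finType) (l : I -> R) (y : I -> 'rV[R]_d) :
  is_polytope P -> (forall i, P (y i)) -> (forall i, 0 <= l i) ->
  \sum_i l i = 1 -> P (\sum_i l i *: y i).
Proof.
move=> [m [q Pq]] Py l0 l1.
have [c yc] := choice (fun i => (Pq (y i)).1 (Py i)).
apply/Pq; exists (fun j => \sum_i l i * c i j); split; [|split].
- by move=> j; apply: sumr_ge0 => i _; rewrite mulr_ge0 //; have [] := yc i.
- rewrite exchange_big /= -l1; apply: eq_bigr => i _.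
  by rewrite -mulr_sumr; have [_ [-> _]] := yc i; rewrite mulr1.
- under [RHS]eq_bigr do rewrite scaler_suml.
  rewrite exchange_big; apply: eq_bigr => i _ /=.
  have [_ [_ {1}->]] := yc i; rewrite scaler_sumr.
  by apply: eq_bigr => j _; rewrite scalerA.
Qed.

(** The slacks [b - dotp a (y i)] are nonnegative and their sum with positive weights is zero, so
    each slack vanishes. *)
Lemma face_extreme P F (I : finType) (l : I -> R) (y : I -> 'rV[R]_d) :
  is_face P F -> (forall i, P (y i)) -> (forall i, 0 < l i) ->
  \sum_i l i = 1 -> F (\sum_i l i *: y i) -> forall i, F (y i).
Proof.
move=> [a [b [Pab Fab]]] Py l0 l1 /Fab [_]; rewrite dotp_sumr => lab i.
apply/Fab; split=> //.
have: \sum_i l i * (b - dotp a (y i)) == 0.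
  under eq_bigr do rewrite mulrBr.
  by rewrite big_split /= sumrN lab -mulr_suml l1 mul1r subrr.
rewrite psumr_eq0; last by move=> j _; rewrite mulr_ge0 ?subr_ge0 ?Pab // ltW.
move=> /allP /(_ i (mem_index_enum _)) /=.
by rewrite mulf_eq0 gt_eqF //= subr_eq0 => /eqP ->.
Qed.

End Faces.

(** * Parallel flats over a simplex and its barycentre, for codimension [m] at least 2 *)

Section ParallelFlats.
Variables (R : realType) (k m : nat).

(** The unit vectors for [i < m], then the vector with all entries -1, and at index [m + 1] the
    origin, which is the barycentre of the others. *)
Definition simplex_center (i : 'I_m.+2) : 'rV[R]_m :=
  \row_l (if (i < m)%N then (i == l :> nat)%:R else - (i == m :> nat)%:R).

Lemma simplex_center_sum (c : 'I_m.+2 -> R) (l : 'I_m) :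
  (\sum_i c i *: simplex_center i) 0 l = c (inord l) - c (inord m).
Proof.
rewrite summxE !big_ord_recr /= !mxE /= ltnn ltnNge leqnSn /= eqxx.
rewrite (gtn_eqF (ltnSn m)) oppr0 mulr0 addr0 mulrN1.
congr (_ - _); last first.
  by congr c; apply: val_inj; rewrite /= inordK // ltnS leqnSn.
rewrite (bigD1 l) //= big1 => [|i il].
  rewrite !mxE /= ltn_ord eqxx mulr1 addr0; congr c; apply: val_inj => /=.
  by rewrite inordK //= (leq_trans (ltn_ord l)) // (leq_addl 2 m).
by rewrite !mxE /= ltn_ord (_ : (i == l :> nat) = false) ?mulr0 //; apply: negbTE.
Qed.

(* The affine dependencies of these points are the multiples of (1, ..., 1, -(m + 1)). *)
Lemma simplex_center_circuit (c : 'I_m.+2 -> R) r :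
  \sum_i c i = 0 -> \sum_i c i *: simplex_center i = 0 -> c r = 0 ->
  forall i, c i = 0.
Proof.
move=> c1 cq cr.
have cm (i : 'I_m.+2) : (i <= m)%N -> c i = c (inord m).
  rewrite leq_eqVlt => /orP[/eqP im|im].
    by congr c; apply: val_inj; rewrite /= inordK // ltnS leqnSn.
  have := simplex_center_sum c (Ordinal im); rewrite cq mxE inord_val => /esym/eqP.
  by rewrite subr_eq0 => /eqP.
have cmax : c ord_max = - (c (inord m) *+ m.+1).
  move: c1; rewrite big_ord_recr /= => /eqP; rewrite addrC addr_eq0 => /eqP ->.
  congr -%R; rewrite (eq_bigr (fun=> c (inord m))) ?sumr_const ?card_ord //.
  by move=> i _; rewrite cm //= -ltnS.
have cm0 : c (inord m) = 0.
  have [/cm <- //|rm] := leqP r m.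
  have rE : r = ord_max.
    by apply: val_inj; apply/eqP; rewrite eqn_leq rm -ltnS ltn_ord.
  by move: cr; rewrite rE cmax => /eqP; rewrite oppr_eq0 mulrn_eq0 /= => /eqP.
move=> i; have [/cm -> //|im] := leqP i m.
have -> : i = ord_max.
  by apply: val_inj; apply/eqP; rewrite eqn_leq im -ltnS ltn_ord.
by rewrite cmax cm0 mul0rn oppr0.
Qed.

Lemma sum_indicator (V : lmodType R) n (f : 'I_n -> V) i :
  \sum_j (j == i)%:R *: f j = f i.
Proof.
rewrite (bigD1 i) //= eqxx scale1r big1 ?addr0 // => j /negbTE ->.
by rewrite scale0r.
Qed.

Lemma sum_indicator1 n (i : 'I_n) : \sum_j (j == i)%:R = 1 :> R.
Proof. by rewrite (bigD1 i) //= eqxx big1 ?addr0 // => j /negbTE ->. Qed.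

Hypothesis m_ge2 : (2 <= m)%N.

(** There are at least four indices. A dependency supported on three of them therefore has a zero
    coefficient, as [simplex_center_circuit] requires. *)
Lemma ord_avoid3 (i j l : 'I_m.+2) : exists r, [/\ r != i, r != j & r != l].
Proof.
case: (pickP [pred r | r \notin [:: i; j; l]]) => [r|none].
  by rewrite !inE !negb_or => /and3P[? ? ?]; exists r.
have := card_size [:: i; j; l]; rewrite (@eq_card _ _ predT) => [|r]; last first.
  by have /negbFE := none r.
by rewrite card_ord !ltnS leqNgt m_ge2.
Qed.

Lemma simplex_center_inj : injective simplex_center.
Proof.
move=> i j ij; apply/eqP; case: (eqVneq i j) => // nij.
have [r [ri rj _]] := ord_avoid3 i j j.
have := @simplex_center_circuit (fun a => (a == i)%:R - (a == j)%:R) r.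
rewrite big_split /= sumrN !sum_indicator1 subrr => /(_ erefl).
under eq_bigr do rewrite scalerBl.
rewrite big_split /= sumrN !sum_indicator ij subrr (negbTE ri) (negbTE rj) subrr.
by move=> /(_ erefl erefl i)/eqP; rewrite eqxx (negbTE nij) subr0 oner_eq0.
Qed.

(** Points with parameters [ti], [tj], [tl] on a line satisfy the affine dependency with
    coefficients [tj - tl], [tl - ti], [ti - tj]. It vanishes at a fourth index, hence is trivial,
    and two of the points coincide. *)
Lemma simplex_center_noncollinear (i j l : 'I_m.+2) :
  i != j -> j != l -> i != l ->
  ~ collinear3 (simplex_center i) (simplex_center j) (simplex_center l).
Proof.
move=> nij njl nil [p [v pv]].
have [|ti qi] := pv (simplex_center i); first by rewrite !inE eqxx.
have [|tj qj] := pv (simplex_center j); first by rewrite !inE eqxx orbT.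
have [|tl ql] := pv (simplex_center l); first by rewrite !inE eqxx !orbT.
have [r [ri rj rl]] := ord_avoid3 i j l.
have := @simplex_center_circuit (fun a => (tj - tl) * (a == i)%:R +
  (tl - ti) * (a == j)%:R + (ti - tj) * (a == l)%:R) r.
rewrite !big_split /= -!mulr_sumr !sum_indicator1.
move=> /(_ ltac:(ring)).
under eq_bigr do rewrite !scalerDl -!scalerA.
rewrite !big_split /= -!scaler_sumr !sum_indicator qi qj ql.
rewrite (negbTE ri) (negbTE rj) (negbTE rl).
have E : (tj - tl) *: (p + ti *: v) + (tl - ti) *: (p + tj *: v) +
    (ti - tj) *: (p + tl *: v) = 0.
  by apply/rowP => a; rewrite !mxE; ring.
move=> /(_ E ltac:(ring) l)/eqP.
rewrite eqxx [l == i]eq_sym [l == j]eq_sym (negbTE nil) (negbTE njl) !mulr0 !add0r mulr1.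
rewrite subr_eq0 => /eqP tij.
by case/negP: nij; apply/eqP/simplex_center_inj; rewrite qi qj tij.
Qed.

Lemma parallel_flats_counterexample :
  exists (n : nat) (U : 'I_n -> 'rV[R]_(k + m) -> Prop),
    injective U /\ (forall i, is_flat k (U i)) /\
    general_position k U /\ ~ convex_position k U.
Proof.
exists m.+2, (fun i x => rsubmx x = simplex_center i).
have Uinj : injective (fun i (x : 'rV[R]_(k + m)) => rsubmx x = simplex_center i).
  move=> i j /(congr1 (fun U : 'rV[R]_(k + m) -> Prop => U (row_mx 0 (simplex_center i)))).
  rewrite row_mxKr => E; apply: simplex_center_inj.
  by have : simplex_center i = simplex_center i by []; rewrite {1}E.
split=> //; split; [|split].
- move=> i; exists (row_mx 0 (simplex_center i)), (row_mx 1%:M 0); split.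
    apply: inj_row_free => v; rewrite mul_mx_row mulmx1 mulmx0.
    by rewrite -row_mx0 => /eq_row_mx [].
  move=> x; split=> [xi|[v ->]].
    exists (lsubmx x).
    by rewrite mul_mx_row mulmx1 mulmx0 add_row_mx add0r addr0 -xi hsubmxK.
  by rewrite mul_mx_row mulmx1 mulmx0 add_row_mx addr0 row_mxKr.
- rewrite /general_position -addnBA // leq_addr.
  (* The transversal flat is the complementary coordinate subspace, which meets each fibre of
     [rsubmx] once. *)
  exists (fun x => lsubmx x = 0), (fun i => row_mx 0 (simplex_center i)).
  rewrite /is_flat addKn; split; [|split; [|split]].
  + exists 0, (row_mx 0 1%:M); split.
      apply: inj_row_free => v; rewrite mul_mx_row mulmx1 mulmx0.
      by rewrite -row_mx0 => /eq_row_mx [].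
    move=> x; split=> [x0|[v ->]].
      by exists (rsubmx x); rewrite mul_mx_row mulmx1 mulmx0 add0r -x0 hsubmxK.
    by rewrite mul_mx_row mulmx1 mulmx0 add0r row_mxKl.
  + move=> i x; split=> [[<- <-]|->]; first by rewrite hsubmxK.
    by rewrite row_mxKl row_mxKr.
  + move=> i j l ij jl il [p [v pv]].
    apply: (simplex_center_noncollinear ij jl il).
    exists (rsubmx p), (rsubmx v) => y yq.
    have [|t E] := pv (row_mx 0 y).
      move: yq; rewrite !inE => /or3P[] /eqP->; rewrite eqxx ?orbT //.
    exists t; move/(congr1 rsubmx): E.
    by rewrite row_mxKr linearD linearZ.
  + have sumE (c : 'I_m.+2 -> R) : \sum_i c i *: row_mx (0 : 'rV_k) (simplex_center i) =
        row_mx 0 (\sum_i c i *: simplex_center i).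
      rewrite -[LHS]hsubmxK !linear_sum /=; congr row_mx.
        by rewrite big1 // => i _; rewrite linearZ /= row_mxKl scaler0.
      by apply: eq_bigr => i _; rewrite linearZ /= row_mxKr.
    move=> x; split=> [x0|[c [_ ->]]]; last by rewrite sumE row_mxKl.
    pose y := rsubmx x.
    (* Affine coordinates of [y]: its entries on the unit vectors, 0 on the vector of entries -1,
       and the remaining weight on the origin, where it contributes nothing. *)
    pose c (i : 'I_m.+2) := if insub (i : nat) is Some l then y 0 l
      else if i == m :> nat then 0 else 1 - \sum_l y 0 l.
    have cl (l : 'I_m) (i : 'I_m.+2) : i = l :> nat -> c i = y 0 l.
      by move=> il; rewrite /c il valK.
    have cm (i : 'I_m.+2) : i = m :> nat -> c i = 0.
      by move=> im; rewrite /c insubF im ?ltnn ?eqxx.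
    exists c; split.
      rewrite !big_ord_recr /= (cm (widen_ord _ _)) //= addr0.
      rewrite {2}/c insubF /= ?ltnNge ?leqnSn // (gtn_eqF (ltnSn m)).
      rewrite addrC [X in _ + X](eq_bigr (fun l => y 0 l)) ?subrK // => l _; exact: cl.
    rewrite sumE -[LHS]hsubmxK x0; congr row_mx; apply/rowP => l.
    rewrite simplex_center_sum (cl l) ?inordK 1?(cm (inord m)) ?inordK ?subr0 //.
    by rewrite (leq_trans (ltn_ord l)) // (leq_addl 2 m).
- case=> P [Ppoly [_ UP]].
  have ne i : exists y, rsubmx y = simplex_center i /\ P y.
    by have [_ [p [B [_ [? _]]]]] := UP i; exists p.
  have [y yP] := choice ne.
  have m1 : 0 < m.+1%:R^-1 :> R by rewrite invr_gt0 ltr0n.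
  have [maxF _] := UP ord_max.
  pose z (i : 'I_m.+1) := y (widen_ord (leqnSn _) i).
  have zP i : P (z i) by have [] := yP (widen_ord (leqnSn _) i).
  have s1 : \sum_(i < m.+1) m.+1%:R^-1 = 1 :> R.
    by rewrite sumr_const card_ord -[_ *+ _]mulr_natr mulVf // pnatr_eq0.
  have avgP := polytope_convex Ppoly zP (fun=> ltW m1) s1.
  have avgU : rsubmx (\sum_i m.+1%:R^-1 *: z i) = simplex_center ord_max.
    (* The uniform weights on the outer points, extended by 0 at the centre, so that each coordinate
       of the sum is a difference of two equal weights. *)
    pose c (i : 'I_m.+2) : R := if (i < m.+1)%N then m.+1%:R^-1 else 0.
    have -> : simplex_center ord_max = 0.
      apply/rowP => l; rewrite !mxE /= ltnNge leqnSn /= (gtn_eqF (ltnSn m)) ?oppr0 //.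
    have <- : \sum_i c i *: simplex_center i = 0.
      apply/rowP => l; rewrite simplex_center_sum mxE /c !inordK ?ltnSn ?ltnS ?leqnSn //.
        by rewrite [(l <= m)%N]ltnW ?subrr.
      by rewrite leqW // ltnW.
    rewrite linear_sum [RHS]big_ord_recr /= {2}/c /= ltnn scale0r addr0.
    apply: eq_bigr => i _; rewrite linearZ /= /c /= ltn_ord /z.
    by have [->] := yP (widen_ord (leqnSn _) i).
  (* The average lies on the central face, hence so does the outer point of index 0; its projection
     would then be that of index [m + 1]. *)
  have [E _] := face_extreme maxF zP (fun=> m1) s1 (conj avgU avgP) ord0.
  move: E; rewrite /z; have [-> _] := yP (widen_ord (leqnSn _) ord0).
  by move/simplex_center_inj/(congr1 val).
Qed.

End ParallelFlats.

(** * Vectors in general linear position chosen from open sets *)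

Section GenericLists.
Variables (R : realType) (V : vectType R).
Implicit Types (s : seq V) (O : V -> Prop).

Definition small_pos (Q : R -> Prop) : Prop :=
  exists2 e : R, 0 < e & forall t : R, 0 < t < e -> Q t.

Lemma small_pos_forall (T : eqType) (s : seq T) (Q : T -> R -> Prop) :
  (forall x, x \in s -> small_pos (Q x)) ->
  small_pos (fun t => forall x, x \in s -> Q x t).
Proof.
elim: s => [_|x s IHs sQ]; first by exists 1.
have [|e e0 He] := IHs; first by move=> y ys; apply: sQ; rewrite inE ys orbT.
have [|e' e'0 He'] := sQ x; first by rewrite inE eqxx.
exists (Num.min e e'); first by rewrite lt_min e0.
move=> t; rewrite lt_min => /and3P[t0 te te'] y; rewrite inE => /orP[/eqP->|ys].
  by apply: He'; rewrite t0.
by apply: He; rewrite ?t0.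
Qed.

Lemma small_pos_and (Q Q' : R -> Prop) :
  small_pos Q -> small_pos Q' -> small_pos (fun t => Q t /\ Q' t).
Proof.
move=> [e e0 He] [e' e'0 He']; exists (Num.min e e'); first by rewrite lt_min e0.
by move=> t; rewrite lt_min => /and3P[t0 te te']; split; [apply: He|apply: He']; rewrite t0.
Qed.

Lemma small_pos_ex (Q : R -> Prop) : small_pos Q -> exists t, Q t.
Proof.
by move=> [e e0 He]; exists (e / 2); apply: He; rewrite divr_gt0 //= ltr_pdivrMr // ltr_pMr // ltr1n.
Qed.

(** Openness along rays only: this suffices for moving a vector off finitely many subspaces and
    needs no topology on [V]. *)
Definition radially_open O : Prop :=
  forall w u, O w -> small_pos (fun t => O (w + t *: u)).

Lemma radially_open_pos (I : finType) (f : I -> V -> R) :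
  (forall i w u t, f i (w + t *: u) = f i w + t * f i u) ->
  radially_open (fun w => forall i, 0 < f i w).
Proof.
move=> flin w u fw.
have [i _|e e0 He] := @small_pos_forall I (enum I) (fun i t => 0 < f i (w + t *: u)).
  (* Below this bound [t * |f i u|] stays smaller than [f i w]; the added 1 keeps the denominator
     positive. *)
  exists (f i w / (1 + `|f i u|)) => [|t /andP[t0]].
    by rewrite divr_gt0 // ltr_wpDr.
  rewrite ltr_pdivlMr ?ltr_wpDr // flin => tf.
  have: - (t * f i u) <= t * `|f i u|.
    by rewrite -mulrN ler_pM2l // -normrN ler_norm.
  lra.
by exists e => // t /He He' i; apply: He'; rewrite mem_enum.
Qed.

(** If [w] is in [W], no positive [t] brings the ray back to [W]. Otherwise at most one positive [t]
    does, since two would put [u] and then [w] in [W]. *)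
Lemma small_pos_notin_vspace (W : {vspace V}) w u :
  (w \notin W) || (u \notin W) -> small_pos (fun t => w + t *: u \notin W).
Proof.
move=> wu; have [wW|wW] := boolP (w \in W).
  exists 1 => // t /andP[t0 _].
  by move: wu; rewrite wW /= => uW; rewrite rpredDl // rpredZeq negb_or gt_eqF.
have [[t0 t0_gt0 t0W]|no] := pselect (exists2 t, 0 < t & w + t *: u \in W); last first.
  by exists 1 => // t /andP[t0 _]; apply/negP => tW; apply: no; exists t.
exists t0 => // t /andP[_ tt0]; apply/negP => tW.
have: (t0 - t) *: u \in W.
  have -> : (t0 - t) *: u = (w + t0 *: u) - (w + t *: u).
    by rewrite scalerBl opprD addrACA subrr add0r.
  exact: memvB.
rewrite rpredZeq subr_eq0 gt_eqF //= => uW.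
by case/negP: wW; rewrite -(addrK (t *: u) w) memvB // memvZ.
Qed.

(** By induction: a vector avoiding the earlier subspaces is pushed slightly in a direction outside
    the new one, which spoils neither the earlier conditions nor [O]. *)
Lemma radially_open_avoid O (Ws : seq {vspace V}) :
  radially_open O -> (exists w, O w) -> (forall W, W \in Ws -> W != fullv) ->
  exists2 w, O w & forall W, W \in Ws -> w \notin W.
Proof.
move=> Oopen Oex; elim: Ws => [|W Ws IHWs] proper; first by case: Oex => w; exists w.
have [|w Ow wWs] := IHWs.
  by move=> W' W'Ws; apply: proper; rewrite inE W'Ws orbT.
have [u uW] : exists u, u \notin W.
  have := proper W; rewrite inE eqxx => /(_ isT); rewrite eqEsubv subvf /= => /subvPn[u _ uW].
  by exists u.
have [t [Ot tWs]] : exists t, O (w + t *: u) /\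
    forall W', W' \in W :: Ws -> w + t *: u \notin W'.
  apply: small_pos_ex; apply: small_pos_and; first exact: Oopen.
  apply: small_pos_forall => W'; rewrite inE => /orP[/eqP->|W'Ws].
    by apply: small_pos_notin_vspace; rewrite uW orbT.
  by apply: small_pos_notin_vspace; rewrite wWs.
by exists (w + t *: u).
Qed.

Definition generic s : Prop :=
  forall t : seq V, subseq t s -> (size t <= \dim {:V})%N -> free t.

Lemma generic_extend s O :
  generic s -> radially_open O -> (exists w, O w) ->
  exists2 w, O w & generic (w :: s).
Proof.
move=> gs Oopen Oex.
(* The spans of all sublists with fewer members than the dimension, enumerated by bit masks; each is
   a proper subspace. *)
pose Ws := [seq <<mask b s>>%VS | b : (size s).-tuple bool <- enum {: (size s).-tuple bool} & (size (mask b s) < \dim {:V})%N].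
have [|w Ow wWs] := @radially_open_avoid O Ws Oopen Oex.
  move=> W /mapP[b]; rewrite mem_filter => /andP[bs _] ->.
  apply: contraTneq bs => E; rewrite -leqNgt -E; exact: dim_span.
exists w => // t; case: t => [|x t]; first by rewrite nil_free.
move=> /=; case: eqP => [-> ts st|_ ts]; last exact: (gs (x :: t)).
rewrite free_cons gs ?andbT // 1?ltnW //.
have /subseqP[b sb tE] := ts; apply: wWs; apply/mapP.
exists (tcast sb (in_tuple b)); last by rewrite val_tcast /= -tE.
by rewrite mem_filter mem_enum val_tcast /= -tE st.
Qed.

Lemma generic_extend_many s O n :
  generic s -> radially_open O -> (exists w, O w) ->
  exists t, [/\ size t = n, forall w, w \in t -> O w & generic (t ++ s)].
Proof.
move=> gs Oopen Oex; elim: n => [|n [t [tn tO tg]]]; first by exists [::].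
have [w Ow wg] := generic_extend tg Oopen Oex.
exists (w :: t); split=> //=; first by rewrite tn.
by move=> x; rewrite inE => /orP[/eqP->|/tO].
Qed.

(** This is the obstruction used later: a linear form that is nonnegative on the basis [t] and zero
    at the positive combination must vanish identically. *)
Definition pos_cluster s O : Prop :=
  exists t (l : 'I_(size t) -> R),
    [/\ free t /\ size t = \dim {:V},
        forall w, w \in t -> w \in s /\ O w,
        forall i, 0 < l i & \sum_i l i *: t`_i \in s].

Lemma pos_cluster_sub s s' O :
  {subset s <= s'} -> pos_cluster s O -> pos_cluster s' O.
Proof.
move=> ss' [t [l [tD tO l0 ls]]]; exists t, l; split=> //; last exact: ss'.
by move=> w /tO[/ss'].
Qed.

Lemma generic_extend_cluster s O :
  generic s -> radially_open O -> (exists w, O w) ->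
  exists s', generic (s' ++ s) /\ pos_cluster s' O.
Proof.
move=> gs Oopen Oex.
have [t [tD tO tg]] := generic_extend_many (\dim {:V}) gs Oopen Oex.
have ft : free t by apply: tg; rewrite ?prefix_subseq ?tD.
have spant : <<t>>%VS = fullv.
  by apply/eqP; rewrite eqEdim subvf (eqnP ft) tD /=.
(* Positivity of all coordinates in the basis [t] describes its open cone; the next generic vector
   is taken there, and its coordinates are the weights. *)
pose f i (w : V) := coord (in_tuple t) i w.
have flin i w u r : f i (w + r *: u) = f i w + r * f i u.
  by rewrite /f linearD linearZ.
have [||w0 w0f w0g] := @generic_extend _ (fun w => forall i, 0 < f i w) tg.
- exact: radially_open_pos.
- exists (\sum_(i < size t) t`_i) => i; rewrite /f linear_sum (bigD1 i) //= big1 => [|j ji].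
    by rewrite (@coord_free _ _ _ (in_tuple t)) // eqxx addr0 ltr01.
  by rewrite (@coord_free _ _ _ (in_tuple t)) // (negbTE ji).
exists (w0 :: t); split=> //; exists t, (f^~ w0); split=> //.
  by move=> w wt; rewrite inE wt orbT; split=> //; apply: tO.
rewrite inE (_ : \sum_i _ = w0) ?eqxx //.
by rewrite [RHS](@coord_span _ _ _ (in_tuple t)) // spant memvf.
Qed.

Lemma generic_clusters s (T : eqType) (r : seq T) (O : T -> V -> Prop) :
  generic s -> (forall x, radially_open (O x)) -> (forall x, exists w, O x w) ->
  exists s', generic (s' ++ s) /\ forall x, x \in r -> pos_cluster s' (O x).
Proof.
move=> gs Oopen Oex; elim: r => [|x r [s' [gs' cs']]]; first by exists [::].
have [s'' [gs'' cs'']] := generic_extend_cluster gs' (Oopen x) (Oex x).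
exists (s'' ++ s'); split=> [|y]; first by rewrite -catA.
rewrite inE => /orP[/eqP->|yr].
  by apply: pos_cluster_sub cs'' => z; rewrite mem_cat => ->.
by apply: pos_cluster_sub (cs' _ yr) => z; rewrite mem_cat orbC => ->.
Qed.

End GenericLists.

(** * Hyperplanes as coefficient vectors in dimension [d + 1] *)

Section Hyperplanes.
Variables (R : realType) (d : nat).
Implicit Types (w : 'rV[R]_(d + 1)) (x y : 'rV[R]_d) (t : seq 'rV[R]_(d + 1)).

Lemma dim_rV N : \dim {: 'rV[R]_N} = N.
Proof. by rewrite dimvf dim_matrix mul1r. Qed.

(** The cokernel matrix of the matrix with rows [t] has a column that [w] does not annihilate; [Y]
    is this column rescaled. *)
Lemma notin_span_separate N (t : seq 'rV[R]_N) (w : 'rV[R]_N) :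
  w \notin <<t>>%VS ->
  exists Y : 'cV[R]_N, (forall v, v \in t -> (v *m Y) 0 0 = 0) /\ (w *m Y) 0 0 = 1.
Proof.
move=> wt; pose A := \matrix_(i < size t) t`_i.
have /rV0Pn[j wj] : w *m cokermx A != 0.
  apply: contra wt => /eqP wA.
  have /submxP[u ->] : (w <= A)%MS by rewrite submxE wA.
  rewrite mulmx_sum_row; apply: memv_suml => i _; apply: memvZ.
  by rewrite rowK memv_span // mem_nth.
have colE (v : 'rV_N) : (v *m col j (cokermx A)) 0 0 = (v *m cokermx A) 0 j.
  by rewrite !mxE; apply: eq_bigr => i _; rewrite mxE.
exists (((w *m cokermx A) 0 j)^-1 *: col j (cokermx A)).
split=> [v /(nthP 0)[i it <-]|]; rewrite -scalemxAr mxE colE; last by rewrite mulVf.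
have -> : t`_i = row (Ordinal it) A by rewrite rowK.
by rewrite -row_mul mulmx_coker !mxE mulr0.
Qed.

Lemma free_annihilator N (t : seq 'rV[R]_N) (Y : 'cV[R]_N) :
  free t -> size t = N -> (forall v, v \in t -> (v *m Y) 0 0 = 0) -> Y = 0.
Proof.
move=> ft tN tY.
have spant : <<t>>%VS = fullv.
  by apply/eqP; rewrite eqEdim subvf (eqnP ft) tN dim_rV /=.
have Y0 (v : 'rV_N) : (v *m Y) 0 0 = 0.
  rewrite (@coord_span _ _ _ (in_tuple t) v) ?spant ?memvf // mulmx_suml summxE.
  by apply: big1 => i _; rewrite -scalemxAl mxE tY ?mulr0 // mem_nth.
by apply/colP => i; rewrite [RHS]mxE -(Y0 (delta_mx 0 i)) -rowE mxE.
Qed.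

(* The hyperplane with coefficient vector w is the zero set of w against (x, -1). *)
Definition homog x : 'cV[R]_(d + 1) := col_mx x^T (const_mx (-1)).

Definition incid w x : R := (w *m homog x) 0 0.

(** The hyperplane at infinity. A column pairing to -1 with it is a point ([homog_surj]); one
    pairing to 0 is a direction ([direction]). *)
Definition infty : 'rV[R]_(d + 1) := row_mx 0 (const_mx 1).

Lemma incidE w x : incid w x = (x *m (lsubmx w)^T) 0 0 - w 0 (rshift d ord0).
Proof.
rewrite /incid -{1}[w]hsubmxK mul_row_col mxE; congr (_ + _).
  by rewrite -[x *m _]trmxK trmx_mul trmxK [RHS]mxE.
by rewrite mxE big_ord1 !mxE mulrN1.
Qed.

Lemma incid_add w x y : incid w (x + y) = incid w x + (y *m (lsubmx w)^T) 0 0.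
Proof. by rewrite !incidE mulmxDl mxE; ring. Qed.

Lemma incid_sum w (I : finType) (l : I -> R) (y : I -> 'rV[R]_d) :
  \sum_i l i = 1 -> incid w (\sum_i l i *: y i) = \sum_i l i * incid w (y i).
Proof.
move=> l1; rewrite incidE mulmx_suml summxE.
under [RHS]eq_bigr do rewrite incidE mulrBr.
rewrite big_split /= sumrN -mulr_suml l1 mul1r; congr (_ - _).
by apply: eq_bigr => i _; rewrite -scalemxAl mxE.
Qed.

Lemma mul_infty (Y : 'cV[R]_(d + 1)) : (infty *m Y) 0 0 = Y (rshift d ord0) 0.
Proof.
by rewrite -{1}[Y]vsubmxK mul_row_col mul0mx add0r mxE big_ord1 !mxE mul1r.
Qed.

Lemma homog_surj (Y : 'cV[R]_(d + 1)) :
  (infty *m Y) 0 0 = -1 -> Y = homog (usubmx Y)^T.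
Proof.
rewrite mul_infty => Y1; rewrite -[LHS]vsubmxK /homog trmxK; congr col_mx.
by apply/colP => i; rewrite !mxE ord1.
Qed.

Lemma mul_infty_homog x : (infty *m homog x) 0 0 = -1.
Proof. by rewrite mul_infty /homog col_mxEd mxE. Qed.

Lemma homog_neq0 x : homog x != 0.
Proof.
apply/eqP => x0; have := mul_infty_homog x; rewrite x0 mulmx0 mxE => /eqP.
by rewrite eq_sym oppr_eq0 oner_eq0.
Qed.

Lemma direction (Y : 'cV[R]_(d + 1)) w :
  (infty *m Y) 0 0 = 0 -> (w *m Y) 0 0 = ((usubmx Y)^T *m (lsubmx w)^T) 0 0.
Proof.
rewrite mul_infty => Y0; rewrite -trmx_mul [RHS]mxE.
rewrite -{1}[Y]vsubmxK -{1}[w]hsubmxK mul_row_col mxE [X in _ + X]mxE big_ord1.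
by rewrite (_ : dsubmx Y 0 0 = 0) ?mulr0 ?addr0 // mxE -Y0; congr (Y _ _).
Qed.

Lemma generic_orthant_clusters : exists s,
  generic (s ++ [:: infty]) /\
  forall e : {ffun 'I_(d + 1) -> bool},
    pos_cluster s (fun w => forall i, 0 < (-1) ^+ e i * w 0 i).
Proof.
have [|||s [gs cs]] := @generic_clusters R 'rV[R]_(d + 1) [:: infty] _
  (enum {ffun 'I_(d + 1) -> bool})
  (fun e w => forall i, 0 < (-1) ^+ e i * w 0 i).
- move=> t /[swap] _; case: t => [|x t] /=; first by rewrite nil_free.
  case: (x =P infty) => // -> /eqP ->; rewrite seq1_free.
  apply/eqP => i0; have := mul_infty (const_mx 1); rewrite i0 mul0mx !mxE => /eqP.
  by rewrite eq_sym oner_eq0.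
- by move=> e; apply: radially_open_pos => i w u r; rewrite !mxE; ring.
- move=> e; exists (\row_i (-1) ^+ e i) => i.
  by rewrite mxE -expr2 sqrr_sign.
by exists s; split=> // e; apply: cs; rewrite mem_enum.
Qed.

(** With the signs of [homog x], every product of coordinates is nonnegative, and the last one is
    positive because the last entry of [homog x] is -1. *)
Lemma orthant_incid_gt0 x :
  exists e : {ffun 'I_(d + 1) -> bool}, forall w,
    (forall i, 0 < (-1) ^+ e i * w 0 i) -> 0 < incid w x.
Proof.
exists [ffun i => homog x i 0 < 0] => w ew.
have wE i : w 0 i * homog x i 0 = (-1) ^+ (homog x i 0 < 0)%R * w 0 i * `|homog x i 0|.
  rewrite {1}[homog x i 0]realEsign ?num_real //; ring.
have w_ge0 i : 0 <= w 0 i * homog x i 0.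
  by rewrite wE mulr_ge0 // ltW //; have := ew i; rewrite ffunE.
rewrite /incid mxE (bigD1 (rshift d ord0)) //= ltr_pwDl ?sumr_ge0 //.
rewrite wE mulr_gt0 //; first by have := ew (rshift d ord0); rewrite ffunE.
by rewrite normr_gt0 /homog col_mxEd mxE oppr_eq0 oner_eq0.
Qed.

(** * Incidences of a generic family of hyperplanes *)

Section GenericFamily.
Variables (s : seq 'rV[R]_(d + 1)) (gs : generic (s ++ [:: infty])).
Local Notation n := (size s).
Implicit Types S : {set 'I_n}.

Definition subfamily S := [seq s`_(i : 'I_n) | i : 'I_n <- enum S].

Lemma size_subfamily S : size (subfamily S) = #|S|.
Proof. by rewrite size_map -cardE. Qed.

Lemma subfamily_subseq S : subseq (subfamily S) s.
Proof.
have sE : [seq s`_(i : 'I_n) | i : 'I_n <- enum 'I_n] = s.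
  by rewrite (map_comp (nth 0 s) val) val_enum_ord map_nth_iota0 ?take_size.
rewrite -[X in subseq _ X]sE map_subseq // /enum_mem subseq_filter filter_subseq andbT.
by apply/allP.
Qed.

Lemma mem_subfamily S i : i \in S -> s`_i \in subfamily S.
Proof. by move=> iS; apply/mapP; exists i; rewrite ?mem_enum. Qed.

Lemma subfamilyP S (Q : 'rV[R]_(d + 1) -> Prop) :
  (forall i, i \in S -> Q s`_i) -> forall v, v \in subfamily S -> Q v.
Proof. by move=> SQ v /mapP[i]; rewrite mem_enum => /SQ ? ->. Qed.

Lemma subfamily_free S : (#|S| <= d)%N -> free (infty :: subfamily S).
Proof.
move=> Sd; have fS : free (subfamily S ++ [:: infty]).
  apply: gs; first by rewrite cat_subseq ?subfamily_subseq ?subseq_refl.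
  by rewrite size_cat size_subfamily dim_rV leq_add2r.
by rewrite -(perm_free (permEl (perm_catC _ _))) in fS.
Qed.

(** Since [infty] is outside the span of the subfamily, some column kills the subfamily but not
    [infty]; normalised to pair to -1, it is a point. *)
Lemma subfamily_meet S : (#|S| <= d)%N ->
  exists x, forall i, i \in S -> incid s`_i x = 0.
Proof.
move=> /subfamily_free; rewrite free_cons => /andP[/notin_span_separate[Y [SY Y1]] _].
have E : - Y = homog (usubmx (- Y))^T by apply: homog_surj; rewrite mulmxN mxE Y1.
exists (usubmx (- Y))^T => i iS.
by rewrite /incid -E mulmxN mxE SY ?oppr0 ?mem_subfamily.
Qed.

(** Here the column also kills [infty], so it is a direction parallel to the hyperplanes of [S] and
    transversal to that of [j]. *)
Lemma subfamily_direction S j : (#|S| < d)%N -> j \notin S ->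
  exists u : 'rV[R]_d,
    (forall i, i \in S -> (u *m (lsubmx s`_i)^T) 0 0 = 0) /\
    (u *m (lsubmx s`_j)^T) 0 0 = 1.
Proof.
move=> Sd jS.
have fjS : free (s`_j :: infty :: subfamily S).
  have := @subfamily_free (j |: S); rewrite cardsU1 jS => /(_ Sd).
  rewrite (@perm_free _ _ _ (s`_j :: infty :: subfamily S)) //.
  rewrite perm_sym (perm_catCA [:: s`_j] [:: infty]) perm_cons perm_sym.
  apply: (@perm_map _ _ _ (enum (j |: S)) (j :: enum S)).
  apply: uniq_perm; rewrite ?enum_uniq //= ?mem_enum ?jS ?enum_uniq //.
  by move=> i; rewrite !inE !mem_enum !inE.
move: fjS; rewrite free_cons => /andP[/notin_span_separate[Y [SY Y1]] _].
have Yi : (infty *m Y) 0 0 = 0 by apply: SY; rewrite inE eqxx.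
exists (usubmx Y)^T; split=> [i iS|]; rewrite -direction //.
by apply: SY; rewrite inE mem_subfamily ?orbT.
Qed.

Lemma subfamily_meet_unique S x y : #|S| = d ->
  (forall i, i \in S -> incid s`_i x = 0) ->
  (forall i, i \in S -> incid s`_i y = 0) -> x = y.
Proof.
move=> Sd Sx Sy.
have: homog x - homog y = 0.
  apply: (free_annihilator (subfamily_free (eq_leq Sd))).
    by rewrite /= size_subfamily Sd addn1.
  move=> v; rewrite inE => /orP[/eqP->|].
    by rewrite mulmxBr mxE [X in _ + X]mxE !mul_infty_homog subrr.
  move: v; apply: subfamilyP => i iS.
  by rewrite mulmxBr mxE [X in _ + X]mxE -!/(incid _ _) Sx ?Sy ?subrr.
move/eqP; rewrite subr_eq0 => /eqP/eq_col_mx[/(congr1 trmx)].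
by rewrite !trmxK.
Qed.

Lemma subfamily_no_meet S x : (d < #|S|)%N ->
  ~ (forall i, i \in S -> incid s`_i x = 0).
Proof.
move=> dS Sx; case/eqP: (homog_neq0 x).
apply: (@free_annihilator _ (take (d + 1) (subfamily S))).
- apply: gs; last by rewrite dim_rV size_take_min geq_minl.
  apply: subseq_trans (prefix_subseq _ _).
  exact: subseq_trans (take_subseq _ _) (subfamily_subseq _).
- by rewrite size_takel // size_subfamily (leq_trans _ dS) // addn1.
- move=> v /mem_take; move: v; exact: subfamilyP.
Qed.

Hypothesis d_ge2 : (2 <= d)%N.

Definition hyp (i : 'I_n) x : Prop := incid s`_i x = 0.

Lemma hyp_normal_neq0 (i : 'I_n) : lsubmx s`_i != 0.
Proof.
have [||u [_ u1]] := @subfamily_direction set0 i; rewrite ?cards0 ?inE ?(ltnW d_ge2) //.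
by apply: contra_eq_neq u1 => ->; rewrite trmx0 mulmx0 mxE eq_sym oner_eq0.
Qed.

(** A point of one hyperplane is moved along a direction parallel to it and transversal to the
    other. *)
Lemma hyp_inj : injective hyp.
Proof.
move=> i j ij; apply/eqP; case: (eqVneq i j) => // nij.
have [||u [iu ju]] := @subfamily_direction [set i] j.
- by rewrite cards1.
- by rewrite inE eq_sym.
have [|x xi] := @subfamily_meet [set i]; first by rewrite cards1 ltnW.
have hxi : hyp i x by apply: xi; rewrite inE.
have hxui : hyp i (x + u) by rewrite /hyp incid_add hxi iu ?inE ?addr0.
move: hxi hxui; rewrite ij /hyp incid_add ju => -> /eqP.
by rewrite add0r oner_eq0.
Qed.

Lemma hyp_flat i : is_flat (d - 1) (hyp i).
Proof.
have [|p ip] := @subfamily_meet [set i]; first by rewrite cards1 ltnW.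
have hp : hyp i p by apply: ip; rewrite inE.
pose K := kermx (lsubmx s`_i)^T.
have rK : \rank K = (d - 1)%N.
  by rewrite mxrank_ker mxrank_tr rank_rV hyp_normal_neq0.
exists p; rewrite -rK; exists (row_base K); split; first exact: row_base_free.
move=> x; have -> : hyp i x <-> (x - p <= row_base K)%MS.
  rewrite eq_row_base -{1}[x](subrK p) addrC /hyp incid_add hp add0r.
  split=> [h|/sub_kermxP -> ]; last by rewrite mxE.
  by apply/sub_kermxP/rowP => j; rewrite ord1 h mxE.
split=> [/submxP[v xv]|[v ->]]; first by exists v; rewrite -xv addrC subrK.
by rewrite addrC addKr submxMl.
Qed.

Lemma hyp_general_position : (d <= n)%N -> general_position (d - 1) hyp.
Proof.
move=> dn; have dF : (d - 1 <= d - 2)%N = false.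
  by case: (d) d_ge2 => [|[|d']] // _; rewrite !subSS !subn0 ltnn.
rewrite /general_position dF; split=> //.
have ex S : exists x, #|S| = d -> forall i, i \in S -> hyp i x.
  have [/eqP Sd|nSd] := boolP (#|S| == d); last by exists 0 => /eqP; rewrite (negbTE nSd).
  by have [|x xS] := @subfamily_meet S; [rewrite Sd|exists x].
have [p pS] := choice ex; exists p; split=> [S Sd x|S S' Sd S'd nSS'].
  split=> [Sx|-> i]; last exact: pS.
  exact: (subfamily_meet_unique Sd Sx (pS _ Sd)).
apply/eqP => pp; apply: (@subfamily_no_meet (S :|: S') (p S)).
  apply: leq_trans (_ : #|S| < _)%N; first by rewrite Sd.
  apply: proper_card; rewrite properEneq subsetUl andbT.
  apply: contra nSS' => /eqP E; rewrite eq_sym eqEcard Sd S'd leqnn andbT.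
  by rewrite E subsetUr.
by move=> i; rewrite inE => /orP[] iS; [|rewrite pp]; apply: pS iS.
Qed.

Lemma hyp_supporting P i x y : is_polytope P ->
  is_face P (fun z => hyp i z /\ P z) -> P x -> P y ->
  0 < incid s`_i x -> 0 <= incid s`_i y.
Proof.
move=> Ppoly face Px Py ix; rewrite leNgt; apply/negP => iy.
pose D := incid s`_i x - incid s`_i y.
have D0 : 0 < D by rewrite subr_gt0 (lt_trans iy).
pose l (b : bool) := (if b then - incid s`_i y else incid s`_i x) / D.
pose z (b : bool) := if b then x else y.
have l0 b : 0 < l b by rewrite divr_gt0 //; case: b; rewrite ?oppr_gt0.
have l1 : \sum_b l b = 1.
  by rewrite big_bool /l /= -mulrDl addrC divff // gt_eqF.
have zP b : P (z b) by case: b.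
have zi : hyp i (\sum_b l b *: z b).
  by rewrite /hyp incid_sum // big_bool /l /=; field; rewrite gt_eqF.
have [yi _] := face_extreme face zP l0 l1
  (conj zi (polytope_convex Ppoly zP (fun b => ltW (l0 b)) l1)) false.
by move: iy; rewrite /= yi ltxx.
Qed.

Lemma hyp_interior P : is_polytope P -> aff_dim P d ->
  exists2 x, P x & forall i, is_face P (fun z => hyp i z /\ P z) -> incid s`_i x != 0.
Proof.
move=> Ppoly [p [B [Bfree [Pp [PB _]]]]].
pose z (o : option 'I_d) := if o is Some j then p + row j B else p.
have zP o : P (z o) by case: o.
have l0 : 0 < d.+1%:R^-1 :> R by rewrite invr_gt0 ltr0n.
have l1 : \sum_(o : option 'I_d) d.+1%:R^-1 = 1 :> R.
  by rewrite sumr_const card_option card_ord -[_ *+ _]mulr_natr mulVf // pnatr_eq0.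
have Px := polytope_convex Ppoly zP (fun=> ltW l0) l1.
exists (\sum_o d.+1%:R^-1 *: z o) => // i face; apply/negP => /eqP xi.
have zi := face_extreme face zP (fun=> l0) l1 (conj xi Px).
case/negP: (hyp_normal_neq0 i); rewrite -trmx_eq0.
have BA : B *m (lsubmx s`_i)^T = 0.
  apply/row_matrixP => j; rewrite row_mul row0; apply/rowP => a; rewrite ord1 [RHS]mxE.
  have [] := zi (Some j); rewrite /= /hyp incid_add.
  by have [-> _] := zi None; rewrite add0r.
have Bunit : B \in unitmx by rewrite -row_free_unit.
by rewrite -[_^T](mulKmx Bunit) BA mulmx0.
Qed.

Hypothesis s_clusters : forall e : {ffun 'I_(d + 1) -> bool},
  pos_cluster s (fun w => forall i, 0 < (-1) ^+ e i * w 0 i).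

Lemma hyp_not_convex_position k : ~ convex_position k hyp.
Proof.
case=> P [Ppoly [Pd UP]].
have [x Px xi] := hyp_interior Ppoly Pd.
have [e ex] := orthant_incid_gt0 x.
have [t [l [[tfree tD] te l0 /(nthP 0)[i0 i0s wi0]]]] := s_clusters e.
have [_ [y [_ [_ [[yi0 Py] _]]]]] := UP (Ordinal i0s).
have ty w : w \in t -> 0 <= incid w y.
  move=> wt; have [/(nthP 0)[i si wE] we] := te _ wt.
  have [face _] := UP (Ordinal si).
  rewrite -wE; apply: (hyp_supporting Ppoly face Px Py).
  by rewrite /= wE; apply: ex.
have : \sum_i l i * incid t`_i y == 0.
  move: yi0; rewrite /hyp /= wi0 /incid mulmx_suml summxE => yi0.
  apply/eqP; rewrite -[RHS]yi0; apply: eq_bigr => i _.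
  by rewrite -scalemxAl [RHS]mxE.
rewrite psumr_eq0; last by move=> i _; rewrite mulr_ge0 ?ty ?mem_nth // ltW.
move=> /allP t0; case/eqP: (homog_neq0 y); apply: (free_annihilator tfree).
  by rewrite tD dim_rV.
move=> w /(nthP 0)[i it <-].
have := t0 (Ordinal it) (mem_index_enum _).
by rewrite /= mulf_eq0 gt_eqF //= => /eqP.
Qed.

End GenericFamily.

Lemma hyperplanes_counterexample : (2 <= d)%N ->
  exists (n : nat) (U : 'I_n -> 'rV[R]_d -> Prop),
    injective U /\ (forall i, is_flat (d - 1) (U i)) /\
    general_position (d - 1) U /\ ~ convex_position (d - 1) U.
Proof.
move=> d_ge2; have [s [gs cs]] := generic_orthant_clusters.
exists (size s), (@hyp s); split; first exact: hyp_inj.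
split; first exact: hyp_flat.
split; last exact: hyp_not_convex_position.
apply: hyp_general_position => //.
have [t [_ [[tfree tD] ts _ _]]] := cs [ffun=> false].
apply: leq_trans (uniq_leq_size (free_uniq tfree) (fun w wt => (ts w wt).1)).
by rewrite tD dim_rV addn1.
Qed.

End Hyperplanes.

Theorem theorem1p2 (R : realType) (d k : nat) :
  (2 <= d)%N -> (k <= d - 1)%N ->
  exists (n : nat) (U : 'I_n -> 'rV[R]_d -> Prop),
    injective U /\
    (forall i, is_flat k (U i)) /\
    general_position k U /\
    ~ convex_position k U.
Proof.
move=> d_ge2; rewrite leq_eqVlt => /orP[/eqP->|kd].
  exact: hyperplanes_counterexample.
have kd' : (k + 2 <= d)%N by rewrite ltn_subRL add1n in kd; rewrite addn2.
rewrite -(subnKC (leq_trans (leq_addr 2 k) kd')).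
by apply: parallel_flats_counterexample; rewrite leq_subRL // (leq_trans (leq_addr 2 k)).
Qed.
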